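(* Let $\mathbb{F}$ be a field. For every integer $k \geq 3$, the variety $\mathbf{Nil}_k(\mathbf{Lie})$ of Lie algebras over $\mathbb{F}$ that are nilpotent of class at most $k$ (regarded as a category, with all Lie algebra homomorphisms as morphisms) is not weakly action representable.
   Context: For a Lie algebra $L$ over $\mathbb{F}$, the lower central series is $L^0 = L$, $L^{j} = [L, L^{j-1}]$ for $j\ge 1$. $L$ is said to be $s$-nilpotent if $L^{s-1}\neq 0$ and $L^{s}=0$. $\mathbf{Nil}_k(\mathbf{Lie})$ is the full subcategory of the category of Lie algebras over $\mathbb{F}$ consisting of all Lie algebras that are $s$-nilpotent for some $s \leq k$, i.e. those with $L^k = 0$ (including the zero algebra). Let $\mathcal{C}$ be a semi-abelian category (every variety of Lie algebras is one). For objects $B, X$ of $\mathcal{C}$, a split extension of $B$ by $X$ is a diagram $X \xrightarrow{\,\kappa\,} A \overset{\alpha}{\underset{\beta}{\rightleftarrows}} B$ in $\mathcal{C}$ (with $\alpha\colon A \to B$, $\beta \colon B \to A$) such that $\alpha\circ\beta = \mathrm{id}_B$ and $(X,\kappa)$ is a kernel of $\alpha$. Two split extensions $(A,\kappa,\alpha,\beta)$ and $(A',\kappa',\alpha',\beta')$ of $B$ by $X$ are isomorphic if there is an isomorphism $\theta\colon A \to A'$ with $\theta\kappa = \kappa'$, $\alpha'\theta = \alpha$ and $\theta\beta = \beta'$. For a fixed object $X$, the functor $\mathrm{SplExt}(-,X)\colon \mathcal{C}^{op}\to \mathbf{Set}$ sends $B$ to the set of isomorphism classes of split extensions (in $\mathcal{C}$)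 of $B$ by $X$, and sends $f\colon B'\to B$ to the map $f^*\colon \mathrm{SplExt}(B,X)\to \mathrm{SplExt}(B',X)$ given by pulling back along $f$. The category $\mathcal{C}$ is weakly action representable if for every object $X$ of $\mathcal{C}$ there exist an object $T = T(X)$ of $\mathcal{C}$ and a natural monomorphism of functors (a natural transformation with all components injective) $\tau\colon \mathrm{SplExt}(-,X) \rightarrowtail \mathrm{Hom}_{\mathcal{C}}(-,T)$. *)

(* Defs.v *)
From HB Require Import structures.
From mathcomp Require Import all_boot all_order all_algebra.
From mathcomp Require Import boolp classical_sets.
(* Used for predicates on split extensions: they live in a larger universe than
   the one of the functional extensionality axiom of boolp. *)
From Stdlib Require FunctionalExtensionality.

Set Implicit Arguments.
Unset Strict Implicit.
Unset Printing Implicit Defensive.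

Import GRing.Theory.
Local Open Scope ring_scope.
Local Open Scope classical_set_scope.

(** * Categories and presheaves *)

Record category := Category {
  Ob :> Type;
  Hom : Ob -> Ob -> Type;
  idc : forall A, Hom A A;
  comp : forall A B C, Hom B C -> Hom A B -> Hom A C;
  compA : forall A B C D (h : Hom C D) (g : Hom B C) (f : Hom A B),
    comp h (comp g f) = comp (comp h g) f;
  comp1c : forall A B (f : Hom A B), comp (idc B) f = f;
  compc1 : forall A B (f : Hom A B), comp f (idc A) = f }.

Arguments Hom {c} A B.
Arguments idc {c} A.
Arguments comp {c A B C} g f.

Notation "g \oc f" := (comp g f) (at level 50, left associativity).

(* Contravariant functors from C to sets. *)
Record presheaf (C : category) := Presheaf {
  psob :> C -> Type;
  psmap : forall B' B : C, Hom B' B -> psob B -> psob B';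
  psmap1 : forall B (x : psob B), psmap (idc B) x = x;
  psmapM : forall B B' B'' (f : Hom B' B) (g : Hom B'' B') (x : psob B),
    psmap (f \oc g) x = psmap g (psmap f x) }.

Record natural_mono (C : category) (P Q : presheaf C) := NaturalMono {
  nattr :> forall B : C, P B -> Q B;
  nattr_natural : forall (B B' : C) (f : Hom B' B) (x : P B),
    nattr (psmap f x) = psmap f (nattr x);
  nattr_inj : forall B : C, injective (@nattr B) }.

Definition hom_presheaf (C : category) (T : C) : presheaf C :=
  @Presheaf C (fun B => Hom B T) (fun B' B f h => h \oc f)
    (fun B h => compc1 h) (fun B B' B'' f g h => compA h f g).

(** * Limits *)

Section Limits.
Variable C : category.

Definition is_iso (A B : C) (f : Hom A B) :=
  exists2 g : Hom B A, g \oc f = idc A & f \oc g = idc B.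

Definition is_zero_object (Z : C) :=
  forall A : C, (exists! f : Hom A Z, True) /\ (exists! f : Hom Z A, True).

Definition is_zero_hom (A B : C) (f : Hom A B) :=
  exists (Z : C) (g : Hom Z B) (h : Hom A Z), is_zero_object Z /\ f = g \oc h.

Definition is_kernel (X A B : C) (k : Hom X A) (a : Hom A B) :=
  is_zero_hom (a \oc k) /\
  forall (Z : C) (u : Hom Z A), is_zero_hom (a \oc u) ->
    exists! w : Hom Z X, k \oc w = u.

Definition is_pullback (A B B' P : C) (a : Hom A B) (f : Hom B' B)
    (p : Hom P A) (q : Hom P B') :=
  a \oc p = f \oc q /\
  forall (Z : C) (u : Hom Z A) (v : Hom Z B'), a \oc u = f \oc v ->
    exists! w : Hom Z P, p \oc w = u /\ q \oc w = v.

(* The part of the structure of a semi-abelian category that is needed to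
   define the functor of split extensions. *)
Definition is_pointed := exists Z : C, is_zero_object Z.
Definition has_pullbacks := forall (A B B' : C) (a : Hom A B) (f : Hom B' B),
  exists (P : C) (p : Hom P A) (q : Hom P B'), is_pullback a f p q.

End Limits.

(** * The functor of split extensions *)

Section SplitExtensions.
Variable C : category.

Record split_ext (B X : C) := SplitExt {
  se_mid : C;
  se_ker : Hom X se_mid;
  se_proj : Hom se_mid B;
  se_sec : Hom B se_mid;
  se_split : se_proj \oc se_sec = idc B;
  se_kerP : is_kernel se_ker se_proj }.

Definition split_ext_iso (B X : C) (e e' : split_ext B X) :=
  exists t : Hom (se_mid e) (se_mid e'),
    [/\ is_iso t, t \oc se_ker e = se_ker e',
        se_proj e' \oc t = se_proj e & t \oc se_sec e = se_sec e'].

(* An isomorphism class is encoded as its membership predicate. *)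
Definition split_ext_class (B X : C) :=
  {c : split_ext B X -> Prop | exists e, c = split_ext_iso e}.

Lemma split_ext_class_eq (B X : C) (c d : split_ext_class B X) :
  (forall e, sval c e <-> sval d e) -> c = d.
Proof.
case: c d => [c cP] [d dP] /= cd; have ecd : c = d.
  by apply: FunctionalExtensionality.functional_extensionality => e; exact/propext.
by case: _ / ecd dP {cd} => dP; rewrite (Prop_irrelevance cP dP).
Qed.

(* e' is a pullback of e along f: the section and the kernel of e' are the
   morphisms into the pullback induced by those of e. *)
Definition is_split_ext_pullback (B B' X : C) (f : Hom B' B)
    (e : split_ext B X) (e' : split_ext B' X) :=
  exists p : Hom (se_mid e') (se_mid e),
    [/\ is_pullback (se_proj e) f p (se_proj e'),
        p \oc se_ker e' = se_ker e & p \oc se_sec e' = se_sec e \oc f].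

Implicit Types (A B X Z : C).

Lemma zero_hom_unique A B (f g : Hom A B) :
  is_zero_hom f -> is_zero_hom g -> f = g.
Proof.
move=> [Z [g1 [h1 [Z0 ->]]]] [Z' [g2 [h2 [Z0' ->]]]].
have [u _] := (Z0 Z').2.
have [_ [a [_ aP]]] := Z0' A.
have [_ [b [_ bP]]] := Z0 B.
have -> : g1 = g2 \oc u by rewrite -(bP g1) ?(bP (g2 \oc u)).
have -> : h2 = u \oc h1.
  have [[a' [_ aP']] _] := Z0' A.
  by rewrite -(aP' h2) ?(aP' (u \oc h1)).
by rewrite compA.
Qed.

Lemma zero_hom_compl A B D (g : Hom B D) (f : Hom A B) :
  is_zero_hom f -> is_zero_hom (g \oc f).
Proof.
move=> [Z [h1 [h2 [Z0 ->]]]].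
by exists Z, (g \oc h1), h2; split=> //; rewrite compA.
Qed.

Lemma zero_hom_compr A B D (g : Hom B D) (f : Hom A B) :
  is_zero_hom g -> is_zero_hom (g \oc f).
Proof.
move=> [Z [h1 [h2 [Z0 ->]]]].
by exists Z, h1, (h2 \oc f); split=> //; rewrite compA.
Qed.

Lemma zero_hom_exists A B : is_pointed C -> exists f : Hom A B, is_zero_hom f.
Proof.
move=> [Z Z0]; have [[h _] _] := Z0 A; have [_ [g _]] := Z0 B.
by exists (g \oc h), Z, g, h.
Qed.

Lemma pullback_ext A B B' P Z (a : Hom A B) (f : Hom B' B)
    (p : Hom P A) (q : Hom P B') (u v : Hom Z P) :
  is_pullback a f p q -> p \oc u = p \oc v -> q \oc u = q \oc v -> u = v.
Proof.
move=> [com uni] epu equ.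
have [|w [_ wP]] := uni Z (p \oc u) (q \oc u); first by rewrite !compA com.
by rewrite -(wP u) // -(wP v).
Qed.

Lemma split_ext_iso_refl B X (e : split_ext B X) : split_ext_iso e e.
Proof.
by exists (idc _); rewrite !comp1c compc1; split=> //; exists (idc _); rewrite comp1c.
Qed.

Lemma split_ext_iso_sym B X (e e' : split_ext B X) :
  split_ext_iso e e' -> split_ext_iso e' e.
Proof.
move=> [t [[s st ts] tk at_ tb]]; exists s; split; first by exists t.
- by rewrite -tk compA st comp1c.
- by rewrite -at_ -compA ts compc1.
- by rewrite -tb compA st comp1c.
Qed.

Lemma split_ext_iso_trans B X (e1 e2 e3 : split_ext B X) :
  split_ext_iso e1 e2 -> split_ext_iso e2 e3 -> split_ext_iso e1 e3.
Proof.
move=> [t [[s st ts] tk at_ tb]] [t' [[s' st' ts'] tk' at' tb']].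
exists (t' \oc t); split.
- exists (s \oc s').
    by rewrite -compA (compA s') st' comp1c st.
  by rewrite -compA (compA t) ts comp1c ts'.
- by rewrite -compA tk.
- by rewrite compA at'.
- by rewrite -compA tb.
Qed.

Lemma split_ext_pullback1 B X (e : split_ext B X) :
  is_split_ext_pullback (idc B) e e.
Proof.
exists (idc _); rewrite !comp1c compc1; split=> //; split.
  by rewrite comp1c compc1.
move=> Z u v; rewrite comp1c => uv; exists u; split; first by rewrite comp1c.
by move=> w [<- _]; rewrite comp1c.
Qed.

Lemma split_ext_pullbackM B B' B'' X (f : Hom B' B) (g : Hom B'' B')
    (e : split_ext B X) (e' : split_ext B' X) (e'' : split_ext B'' X) :
  is_split_ext_pullback f e e' -> is_split_ext_pullback g e' e'' ->
  is_split_ext_pullback (f \oc g) e e''.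
Proof.
move=> [p [[pc pu] pk pb]] [q [[qc qu] qk qb]].
exists (p \oc q); split.
- split; first by rewrite compA pc -compA qc compA.
  move=> Z u v uv.
  have [|w [[w1 w2] wP]] := pu Z u (g \oc v); first by rewrite compA.
  have [|x [[x1 x2] xP]] := qu Z w v; first by rewrite w2.
  exists x; split; first by rewrite -compA x1.
  move=> y [y1 y2]; apply: xP; split=> //.
  by apply/esym/wP; rewrite compA y1 compA qc -compA y2.
- by rewrite -compA qk.
- by rewrite -compA qb compA pb compA.
Qed.

Lemma split_ext_pullback_uniq B B' X (f : Hom B' B) (e : split_ext B X)
    (e1 e2 : split_ext B' X) :
  is_pointed C ->
  is_split_ext_pullback f e e1 -> is_split_ext_pullback f e e2 ->
  split_ext_iso e1 e2.
Proof.
move=> C0 [p [pp pk pb]] [q [qq qk qb]].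
have [t [[t1 t2] _]] := qq.2 _ _ _ pp.1.
have [s [[s1 s2] _]] := pp.2 _ _ _ qq.1.
have zk (d1 d2 : split_ext B' X) : se_proj d1 \oc se_ker d1 =
    se_proj d2 \oc se_ker d2.
  exact: zero_hom_unique (se_kerP d1).1 (se_kerP d2).1.
exists t; split.
- exists s; apply: pullback_ext; first exact: pp.
  + by rewrite compA s1 t1 compc1.
  + by rewrite compA s2 t2 compc1.
  + exact: qq.
  + by rewrite compA t1 s1 compc1.
  + by rewrite compA t2 s2 compc1.
- apply: pullback_ext; first exact: qq.
    by rewrite compA t1 pk qk.
  by rewrite compA t2 (zk e1 e2).
- by [].
- apply: pullback_ext; first exact: qq.
    by rewrite compA t1 pb qb.
  by rewrite compA t2 !se_split.
Qed.

Lemma split_ext_pullback_isor B B' X (f : Hom B' B) (e : split_ext B X)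
    (e1 e2 : split_ext B' X) :
  is_split_ext_pullback f e e1 -> split_ext_iso e1 e2 ->
  is_split_ext_pullback f e e2.
Proof.
move=> [p [[pc pu] pk pb]] /split_ext_iso_sym [s [[t ts st] sk sa sb]].
exists (p \oc s); split.
- split; first by rewrite compA pc -compA sa.
  move=> Z u v uv; have [w [[w1 w2] wP]] := pu Z u v uv.
  exists (t \oc w); split.
    by rewrite -compA (compA s) st comp1c -sa -compA (compA s) st comp1c.
  move=> y [y1 y2]; rewrite (wP (s \oc y)) ?compA ?ts ?comp1c //.
  by rewrite sa.
- by rewrite -compA sk.
- by rewrite -compA sb.
Qed.

Lemma split_ext_iso_pullback B X (e e' : split_ext B X) :
  split_ext_iso e e' -> is_split_ext_pullback (idc B) e e'.
Proof. by move=> /(split_ext_pullback_isor (split_ext_pullback1 e)). Qed.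

Lemma split_ext_pullback_isol B B' X (f : Hom B' B) (e1 e2 : split_ext B X)
    (e' : split_ext B' X) :
  split_ext_iso e1 e2 -> is_split_ext_pullback f e2 e' ->
  is_split_ext_pullback f e1 e'.
Proof.
by move=> /split_ext_iso_pullback /split_ext_pullbackM H /H; rewrite comp1c.
Qed.

Lemma split_ext_pullback_exists B B' X (f : Hom B' B) (e : split_ext B X) :
  is_pointed C -> has_pullbacks C -> exists e', is_split_ext_pullback f e e'.
Proof.
case: e => A k a b ab [kz kP] C0 /(_ _ _ _ a f) [P [p [q pb]]].
have [|b' [[b1 b2] _]] := pb.2 _ (b \oc f) (idc B').
  by rewrite compA ab comp1c compc1.
have [z z0] := zero_hom_exists X B' C0.
have [|k' [[k1 k2] _]] := pb.2 _ k z.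
  exact: zero_hom_unique kz (zero_hom_compl f z0).
have kerk' : is_kernel k' q.
  split; first by rewrite k2.
  move=> Z u u0; have [|w [wu wP]] := kP Z (p \oc u).
    by rewrite compA pb.1 -compA; exact: zero_hom_compl.
  exists w; split.
    apply: pullback_ext; first exact: pb.
      by rewrite compA k1.
    rewrite compA k2; apply: zero_hom_unique u0.
    exact: zero_hom_compr.
  by move=> y yu; apply: wP; rewrite -yu compA k1.
by exists (SplitExt b2 kerk'), p; split.
Qed.

Hypotheses (C0 : is_pointed C) (Cpb : has_pullbacks C).

(* The isomorphism class of the pullbacks along f of the members of c. *)
Definition pullback_class_pred B B' X (f : Hom B' B)
    (c : split_ext_class B X) (e' : split_ext B' X) : Prop :=
  exists2 e, sval c e & is_split_ext_pullback f e e'.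

Lemma pullback_class_subproof B B' X (f : Hom B' B) (c : split_ext_class B X) :
  exists e', pullback_class_pred f c = split_ext_iso e'.
Proof.
have [e ce] := svalP c.
have [e' ee'] := split_ext_pullback_exists f e C0 Cpb.
exists e'; apply: FunctionalExtensionality.functional_extensionality => e''.
apply/propext; rewrite /pullback_class_pred ce; split.
  move=> [e1 /split_ext_pullback_isol H /H].
  exact: split_ext_pullback_uniq C0 ee'.
move=> /(split_ext_pullback_isor ee') H; exists e => //.
exact: split_ext_iso_refl.
Qed.

Definition pullback_class B B' X (f : Hom B' B) (c : split_ext_class B X) :
    split_ext_class B' X :=
  exist _ (pullback_class_pred f c) (pullback_class_subproof f c).

Lemma pullback_class1 B X (c : split_ext_class B X) :
  pullback_class (idc B) c = c.
Proof.
apply: split_ext_class_eq => e' /=.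
have [e ce] := svalP c; rewrite /pullback_class_pred ce; split.
  move=> [e1 ee1 e1e']; apply: split_ext_iso_trans ee1 _.
  exact: split_ext_pullback_uniq C0 (split_ext_pullback1 _) e1e'.
by move=> ee'; exists e; [exact: split_ext_iso_refl|exact: split_ext_iso_pullback].
Qed.

Lemma pullback_classM B B' B'' X (f : Hom B' B) (g : Hom B'' B')
    (c : split_ext_class B X) :
  pullback_class (f \oc g) c = pullback_class g (pullback_class f c).
Proof.
apply: split_ext_class_eq => e'' /=; split.
  move=> [e ce ee''].
  have [e1 ee1] := split_ext_pullback_exists f e C0 Cpb.
  have [e2 e12] := split_ext_pullback_exists g e1 C0 Cpb.
  exists e1; first by exists e.
  apply: (split_ext_pullback_isor e12).
  exact: split_ext_pullback_uniq C0 (split_ext_pullbackM ee1 e12) ee''.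
by move=> [e1 [e ce ee1] e1e'']; exists e => //; exact: split_ext_pullbackM ee1 e1e''.
Qed.

Definition SplExt (X : C) : presheaf C :=
  @Presheaf C (fun B => split_ext_class B X)
    (fun B' B f => @pullback_class B B' X f)
    (fun B => @pullback_class1 B X) (fun B B' B'' => @pullback_classM B B' B'' X).

Definition weakly_action_representable :=
  forall X : C, exists T : C, inhabited (natural_mono (SplExt X) (hom_presheaf T)).

End SplitExtensions.

(** * Lie algebras *)

HB.mixin Record Lmodule_isLieAlgebra (F : fieldType) L of GRing.Lmodule F L := {
  bracket : L -> L -> L;
  bracket_linearl : forall y, linear (fun x => bracket x y);
  bracket_linearr : forall x, linear (fun y => bracket x y);
  bracketxx : forall x, bracket x x = 0;
  jacobi : forall x y z,
    bracket x (bracket y z) + bracket y (bracket z x)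
      + bracket z (bracket x y) = 0 }.

#[short(type="lieAlgType")]
HB.structure Definition LieAlgebra (F : fieldType) :=
  {L of GRing.Lmodule F L & Lmodule_isLieAlgebra F L}.

Section LieAlgebras.
Variable F : fieldType.
Implicit Types L M N : lieAlgType F.

Inductive lspan (V : lmodType F) (S : set V) : set V :=
| lspan0 : lspan S 0
| lspan_lin a u v : S u -> lspan S v -> lspan S (a *: u + v).

Fixpoint lower_central L (j : nat) : set L :=
  if j is i.+1 then
    lspan [set z | exists x, exists2 y, @lower_central L i y & z = bracket x y]
  else setT.

Arguments lower_central L j _ : clear implicits.

(* L^0 = L, hence L^k = 0 means nilpotent of class at most k. *)
Definition nilpotent_le (k : nat) L := lower_central L k = [set 0].

Definition lie_morphism L M (f : L -> M) :=
  linear f /\ forall x y, f (bracket x y) = bracket (f x) (f y).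

Lemma lie_morphism0 L M (f : L -> M) : lie_morphism f -> f 0 = 0.
Proof.
by move=> [lf _]; have := lf (-1) 0 0; rewrite scaler0 addr0 scaleN1r addNr.
Qed.

Lemma bracket0l L (y : L) : bracket 0 y = 0.
Proof.
have := bracket_linearl y (-1) 0 0.
by rewrite scaler0 addr0 scaleN1r addNr.
Qed.

Lemma bracket0r L (x : L) : bracket x 0 = 0.
Proof.
have := bracket_linearr x (-1) 0 0.
by rewrite scaler0 addr0 scaleN1r addNr.
Qed.

Lemma lower_central0 L j : lower_central L j 0.
Proof. by case: j => // j; exact: lspan0. Qed.

Lemma lie_morphism_lower_central L M (f : L -> M) j x : lie_morphism f ->
  lower_central L j x -> lower_central M j (f x).
Proof.
move=> fL; elim: j x => //= j IHj x; elim=> [|a u v [y [z zj ->]] _ IHv].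
  by rewrite (lie_morphism0 fL); exact: lspan0.
by rewrite fL.1; apply: lspan_lin => //; exists (f y), (f z); [exact: IHj|rewrite fL.2].
Qed.

Lemma lie_morphism_id L : lie_morphism (@idfun L).
Proof. by []. Qed.

Lemma lie_morphism_comp L M N (g : M -> N) (f : L -> M) :
  lie_morphism g -> lie_morphism f -> lie_morphism (g \o f).
Proof.
move=> [lg bg] [lf bf]; split=> [a u v|u v] /=; first by rewrite lf lg.
by rewrite bf bg.
Qed.

Lemma eq_pair (T U : Type) (u v : T * U) : u.1 = v.1 -> u.2 = v.2 -> u = v.
Proof. by case: u v => [? ?] [? ?] /= -> ->. Qed.

Section Product.
Variables L M : lieAlgType F.

Definition prod_bracket (u v : L * M) : L * M :=
  (bracket u.1 v.1, bracket u.2 v.2).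

Fact prod_bracket_linearl y : linear (fun x => prod_bracket x y).
Proof. by move=> a u v; apply: eq_pair; rewrite /= bracket_linearl. Qed.
Fact prod_bracket_linearr x : linear (fun y => prod_bracket x y).
Proof. by move=> a u v; apply: eq_pair; rewrite /= bracket_linearr. Qed.
Fact prod_bracketxx x : prod_bracket x x = 0.
Proof. by apply: eq_pair; rewrite /= bracketxx. Qed.
Fact prod_jacobi x y z :
  prod_bracket x (prod_bracket y z) + prod_bracket y (prod_bracket z x)
    + prod_bracket z (prod_bracket x y) = 0.
Proof. by apply: eq_pair; rewrite /= jacobi. Qed.

HB.instance Definition _ := @Lmodule_isLieAlgebra.Build F (L * M)%type prod_bracket
  prod_bracket_linearl prod_bracket_linearr prod_bracketxx prod_jacobi.

End Product.

Section Subalgebra.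
Variable L : lieAlgType F.

Record lie_subalg := LieSubalg {
  lie_subalg_pred :> {pred L};
  lie_subalg_submod : submod_closed lie_subalg_pred;
  lie_subalg_bracket : {in lie_subalg_pred &, forall x y,
    bracket x y \in lie_subalg_pred} }.

Variable S : lie_subalg.

HB.instance Definition _ :=
  GRing.isSubmodClosed.Build F L (lie_subalg_pred S) (lie_subalg_submod S).

Record lie_sub := LieSub { lie_sub_val : L; _ : lie_sub_val \in lie_subalg_pred S }.
HB.instance Definition _ := [isSub for lie_sub_val].
HB.instance Definition _ := [Choice of lie_sub by <:].
HB.instance Definition _ := [SubChoice_isSubZmodule of lie_sub by <:].
HB.instance Definition _ := [SubZmodule_isSubLmodule of lie_sub by <:].

Definition sub_bracket (u v : lie_sub) : lie_sub :=
  LieSub (lie_subalg_bracket (valP u) (valP v)).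

Fact sub_bracket_linearl y : linear (fun x => sub_bracket x y).
Proof. by move=> a u v; apply: val_inj; rewrite /= bracket_linearl. Qed.
Fact sub_bracket_linearr x : linear (fun y => sub_bracket x y).
Proof. by move=> a u v; apply: val_inj; rewrite /= bracket_linearr. Qed.
Fact sub_bracketxx x : sub_bracket x x = 0.
Proof. by apply: val_inj; rewrite /= bracketxx. Qed.
Fact sub_jacobi x y z :
  sub_bracket x (sub_bracket y z) + sub_bracket y (sub_bracket z x)
    + sub_bracket z (sub_bracket x y) = 0.
Proof. by apply: val_inj; rewrite /= jacobi. Qed.

HB.instance Definition _ := @Lmodule_isLieAlgebra.Build F lie_sub sub_bracket
  sub_bracket_linearl sub_bracket_linearr sub_bracketxx sub_jacobi.

End Subalgebra.

Definition zero_lie : Type := unit.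
HB.instance Definition _ := Choice.on zero_lie.

Lemma zero_lie_eq (x y : zero_lie) : x = y.
Proof. by case: x; case: y. Qed.

HB.instance Definition _ := GRing.isZmodule.Build zero_lie
  (zero := tt) (opp := fun _ => tt) (add := fun _ _ => tt)
  (fun _ _ _ => zero_lie_eq _ _) (fun _ _ => zero_lie_eq _ _)
  (fun _ => zero_lie_eq _ _) (fun _ => zero_lie_eq _ _).
HB.instance Definition _ := GRing.Zmodule_isLmodule.Build F zero_lie
  (scale := fun _ _ => tt) (fun _ _ _ => zero_lie_eq _ _)
  (fun _ => zero_lie_eq _ _) (fun _ _ _ => zero_lie_eq _ _) (fun _ _ _ => zero_lie_eq _ _).

HB.instance Definition _ := @Lmodule_isLieAlgebra.Build F zero_lie (fun _ _ => 0)
  (fun _ _ _ _ => zero_lie_eq _ _) (fun _ _ _ _ => zero_lie_eq _ _)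
  (fun _ => zero_lie_eq _ _) (fun _ _ _ => zero_lie_eq _ _).

(** * The category of Lie algebras L with L^k = 0 *)

Section NilLie.
Variable k : nat.

Definition nil_lie_ob := {L : lieAlgType F | nilpotent_le k L}.
Definition nil_lie_hom (L M : nil_lie_ob) :=
  {f : sval L -> sval M | lie_morphism f}.

Definition nil_lie_id (L : nil_lie_ob) : nil_lie_hom L L :=
  exist _ idfun (lie_morphism_id (sval L)).
Definition nil_lie_comp (L M N : nil_lie_ob) (g : nil_lie_hom M N)
    (f : nil_lie_hom L M) : nil_lie_hom L N :=
  exist _ (sval g \o sval f) (lie_morphism_comp (svalP g) (svalP f)).

Lemma nil_lie_homP (L M : nil_lie_ob) (f g : nil_lie_hom L M) :
  sval f =1 sval g -> f = g.
Proof.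
by case: f g => [f fP] [g gP] /= fg; apply: eq_exist; exact/funext.
Qed.

Definition Nil_Lie : category.
Proof.
refine (@Category nil_lie_ob nil_lie_hom nil_lie_id nil_lie_comp _ _ _).
- by move=> *; exact: nil_lie_homP.
- by move=> *; exact: nil_lie_homP.
- by move=> *; exact: nil_lie_homP.
Defined.

Lemma nilpotent_le_zero : nilpotent_le k (zero_lie : lieAlgType F).
Proof.
apply/seteqP; split=> x /= _; first exact: zero_lie_eq.
by rewrite (zero_lie_eq x 0); exact: lower_central0.
Qed.

Lemma Nil_Lie_pointed : is_pointed Nil_Lie.
Proof.
pose Z : Nil_Lie := exist _ (zero_lie : lieAlgType F) nilpotent_le_zero.
exists Z => A; split.
- have f0 : lie_morphism (fun _ : sval A => 0 : zero_lie).
    by split=> [c u v|u v]; exact: zero_lie_eq.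
  exists (exist _ _ f0 : Hom A Z); split=> // g _; apply: nil_lie_homP => x.
  exact: zero_lie_eq.
- have f0 : lie_morphism (fun _ : zero_lie => 0 : sval A).
    by split=> [c u v|u v]; rewrite ?scaler0 ?addr0 ?bracket0l.
  exists (exist _ _ f0 : Hom Z A); split=> // g _; apply: nil_lie_homP => x /=.
  by rewrite (zero_lie_eq x 0) (lie_morphism0 (svalP g)).
Qed.

Section Pullback.
Variables (A B B' : lieAlgType F) (a : A -> B) (f : B' -> B).
Hypotheses (aP : lie_morphism a) (fP : lie_morphism f).

Let pb_pred : {pred A * B'} := [pred u | a u.1 == f u.2].

Fact pb_submod : submod_closed pb_pred.
Proof.
split=> [|c u v]; rewrite !inE /=; first by rewrite !lie_morphism0.
by move=> /eqP uu /eqP vv; rewrite aP.1 fP.1 uu vv.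
Qed.

Fact pb_bracket : {in pb_pred &, forall u v, bracket u v \in pb_pred}.
Proof.
by move=> u v; rewrite !inE /= aP.2 fP.2 => /eqP -> /eqP ->.
Qed.

Definition pb_subalg := LieSubalg pb_submod pb_bracket.
Definition pb_fst (u : lie_sub pb_subalg) : A := (val u).1.
Definition pb_snd (u : lie_sub pb_subalg) : B' := (val u).2.

Lemma pb_fst_morphism : lie_morphism pb_fst. Proof. by []. Qed.
Lemma pb_snd_morphism : lie_morphism pb_snd. Proof. by []. Qed.

Lemma pb_com u : a (pb_fst u) = f (pb_snd u).
Proof. by case: u => u uP; exact/eqP. Qed.

Lemma pb_nilpotent : nilpotent_le k A -> nilpotent_le k B' ->
  nilpotent_le k (lie_sub pb_subalg : lieAlgType F).
Proof.
move=> nA nB'; apply/seteqP; split=> [u uk|_ ->]; last exact: lower_central0.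
have /= := lie_morphism_lower_central pb_fst_morphism uk; rewrite nA => /= u1.
have /= := lie_morphism_lower_central pb_snd_morphism uk; rewrite nB' => /= u2.
by apply: val_inj; apply: eq_pair.
Qed.

End Pullback.

Lemma Nil_Lie_pullbacks : has_pullbacks Nil_Lie.
Proof.
move=> [A nA] [B nB] [B' nB'] [a aP] [f fP].
pose S := pb_subalg aP fP.
pose P : Nil_Lie := exist _ (lie_sub S : lieAlgType F) (pb_nilpotent aP fP nA nB').
exists P, (exist _ _ (pb_fst_morphism aP fP)), (exist _ _ (pb_snd_morphism aP fP)).
split; first by apply: nil_lie_homP => u; exact: pb_com.
move=> [Z nZ] [u uP] [v vP] uv.
have uvx x : a (u x) = f (v x) by exact: (congr1 (fun h => sval h x) uv).
have mem x : (u x, v x) \in lie_subalg_pred S by rewrite inE /= uvx.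
have wP : lie_morphism (fun x => LieSub (mem x) : lie_sub S).
  split=> [c x y|x y]; apply: val_inj; apply: eq_pair; rewrite /= ?uP.1 ?vP.1 //.
  - by rewrite uP.2.
  - by rewrite vP.2.
exists (exist _ _ wP); split; first by split; exact: nil_lie_homP.
move=> [w wP'] [w1 w2]; apply: nil_lie_homP => x; apply: val_inj => /=.
have e1 : (val (w x)).1 = u x by exact: (congr1 (fun h => sval h x) w1).
have e2 : (val (w x)).2 = v x by exact: (congr1 (fun h => sval h x) w2).
by apply: eq_pair.
Qed.

End NilLie.

End LieAlgebras.

Arguments lower_central {F} L j _.

(* Main.v *)
From HB Require Import structures.
From mathcomp Require Import all_boot all_order all_algebra.
From mathcomp Require Import boolp classical_sets.
From mathcomp Require Import ring.
Require Import Defs.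

(**
Let X be abelian of dimension k + 2, with a weakly representing object T.
A square-zero matrix P defines an action of a line on X, and hence an element
phi P of T, with phi injective and phi 0 = 0. If P P = Q Q = Q P = 0, then
P, Q and P Q = [P, Q] define an action of the Heisenberg algebra on X whose
semidirect product has class at most 3 <= k, and naturality gives
phi (P Q) = [phi P, phi Q]. Applied to E_(m+1,0) = E_(m+1,m) E_(m,0), this
puts phi E_(m+1,0) in T^m; hence phi E_(k+1,0) = 0, contradicting injectivity.
*)

Set Implicit Arguments.
Unset Strict Implicit.
Unset Printing Implicit Defensive.

Import GRing.Theory.
Local Open Scope ring_scope.
Local Open Scope classical_set_scope.

(** * Isomorphism classes of split extensions and their representatives *)

Section SplitExtensionClasses.
Variable C : category.
Hypotheses (C0 : is_pointed C) (Cpb : has_pullbacks C).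

Definition class_of_split_ext (B X : C) (e : split_ext B X) :
    split_ext_class B X :=
  exist _ (split_ext_iso e) (ex_intro _ e erefl).

Lemma class_of_split_ext_inj (B X : C) (e e' : split_ext B X) :
  class_of_split_ext e = class_of_split_ext e' -> split_ext_iso e e'.
Proof.
move=> /(congr1 (fun c => sval c e')) /= ->; exact: split_ext_iso_refl.
Qed.

(** Turns naturality statements about classes into the construction of one concrete pullback. *)
Lemma pullback_class_of_split_ext (B B' X : C) (f : Hom B' B)
    (e : split_ext B X) (e' : split_ext B' X) :
  is_split_ext_pullback f e e' ->
  pullback_class C0 Cpb f (class_of_split_ext e) = class_of_split_ext e'.
Proof.
move=> ee'; apply: split_ext_class_eq => e'' /=; split.
  move=> [e1 /split_ext_pullback_isol H /H].
  exact: split_ext_pullback_uniq.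
move=> /(split_ext_pullback_isor ee') H; exists e => //.
exact: split_ext_iso_refl.
Qed.

End SplitExtensionClasses.

(** * Lower central series and a criterion for nilpotency *)

Section LowerCentralSeries.
Variables (F : fieldType) (L : lieAlgType F).

Lemma lower_central_bracket j (x y : L) :
  lower_central L j y -> lower_central L j.+1 (bracket x y).
Proof.
move=> yj; rewrite -[bracket x y]scale1r -[_ *: _]addr0.
by apply: lspan_lin; [exists x, y|exact: lspan0].
Qed.

Lemma lower_central_ind j (P : L -> Prop) :
  P 0 -> (forall a u v, P u -> P v -> P (a *: u + v)) ->
  (forall x y : L, lower_central L j y -> P (bracket x y)) ->
  forall y, lower_central L j.+1 y -> P y.
Proof.
move=> P0 Plin H y; elim=> [//|a u v [x [z zj ->]] _ Pv].
exact: Plin (H _ _ zj) Pv.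
Qed.

Lemma nilpotent_le_class3 k : (3 <= k)%N ->
  (forall x y z t : L, bracket x (bracket y (bracket z t)) = 0) ->
  nilpotent_le k L.
Proof.
move=> k3 H; apply/seteqP; split=> [y|_ ->]; last exact: lower_central0.
have lin0 a (u v : L) : u = 0 -> v = 0 -> a *: u + v = 0.
  by move=> -> ->; rewrite scaler0 addr0.
(* With k = 3 + m, the base case peels off three brackets down to L^0 = L; the later terms are
   spanned by brackets with 0. *)
rewrite -(subnK k3) addnC; elim: (k - 3)%N y => [|m IHm] y.
  apply: lower_central_ind => // x; apply: lower_central_ind.
  - by rewrite bracket0r.
  - by move=> a u v Hu Hv; rewrite bracket_linearr; exact: lin0.
  move=> {}y; apply: lower_central_ind; last by move=> z t _; exact: H.
  - by rewrite !bracket0r.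
  - by move=> a u v Hu Hv; rewrite !bracket_linearr; exact: lin0.
rewrite addnS; apply: lower_central_ind => // x z /IHm ->.
exact: bracket0r.
Qed.

End LowerCentralSeries.

(** * Abelian Lie algebras *)

Section AbelianLie.
Variables (F : fieldType) (V : lmodType F).

Definition abelian_lie : Type := V.
HB.instance Definition _ := GRing.Lmodule.on abelian_lie.

Definition abelian_bracket (x y : abelian_lie) : abelian_lie := 0.

Fact abelian_linearl y : linear (fun x => abelian_bracket x y).
Proof. by move=> a u v; rewrite /abelian_bracket scaler0 addr0. Qed.
Fact abelian_linearr x : linear (fun y => abelian_bracket x y).
Proof. by move=> a u v; rewrite /abelian_bracket scaler0 addr0. Qed.
Fact abelian_jacobi x y z :
  abelian_bracket x (abelian_bracket y z)
    + abelian_bracket y (abelian_bracket z x)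
    + abelian_bracket z (abelian_bracket x y) = 0.
Proof. by rewrite /abelian_bracket !addr0. Qed.

HB.instance Definition _ := @Lmodule_isLieAlgebra.Build F abelian_lie
  abelian_bracket abelian_linearl abelian_linearr (fun=> erefl) abelian_jacobi.

Lemma abelian_nilpotent k : (3 <= k)%N ->
  nilpotent_le k (abelian_lie : lieAlgType F).
Proof. by move=> k3; exact: nilpotent_le_class3. Qed.

End AbelianLie.

(** * The Heisenberg algebra *)

Section Heisenberg.
Variable F : fieldType.

Definition heisenberg : Type := (F^o * F^o * F^o)%type.
HB.instance Definition _ := GRing.Lmodule.on heisenberg.

Definition heis_bracket (u v : heisenberg) : heisenberg :=
  (0, 0, u.1.1 * v.1.2 - u.1.2 * v.1.1).

Lemma heis_eq (u v : heisenberg) :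
  u.1.1 = v.1.1 -> u.1.2 = v.1.2 -> u.2 = v.2 -> u = v.
Proof. by case: u v => [[? ?] ?] [[? ?] ?] /= -> -> ->. Qed.

Fact heis_linearl y : linear (fun x => heis_bracket x y).
Proof.
move=> a u v; apply: heis_eq => /=; rewrite ?scaler0 ?addr0 //.
by rewrite /GRing.scale /=; ring.
Qed.
Fact heis_linearr x : linear (fun y => heis_bracket x y).
Proof.
move=> a u v; apply: heis_eq => /=; rewrite ?scaler0 ?addr0 //.
by rewrite /GRing.scale /=; ring.
Qed.
Fact heis_bracketxx x : heis_bracket x x = 0.
Proof. by apply: heis_eq => //=; ring. Qed.
Fact heis_bracket3 x y z : heis_bracket x (heis_bracket y z) = 0.
Proof. by apply: heis_eq => //=; ring. Qed.
Fact heis_jacobi x y z :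
  heis_bracket x (heis_bracket y z) + heis_bracket y (heis_bracket z x)
    + heis_bracket z (heis_bracket x y) = 0.
Proof. by rewrite !heis_bracket3 !addr0. Qed.

HB.instance Definition _ := @Lmodule_isLieAlgebra.Build F heisenberg
  heis_bracket heis_linearl heis_linearr heis_bracketxx heis_jacobi.

Definition heis_x : heisenberg := (1, 0, 0).
Definition heis_y : heisenberg := (0, 1, 0).
Definition heis_z : heisenberg := (0, 0, 1).

Lemma heis_bracket_xy : bracket heis_x heis_y = heis_z.
Proof. by apply: heis_eq => //=; ring. Qed.

(* Factors through a line, which thus need not be considered separately. *)
Definition heis_line (v : heisenberg) (u : heisenberg) : heisenberg :=
  (u.1.1 : F) *: v.

Lemma heis_line_morphism v : lie_morphism (heis_line v).
Proof.
split=> [a u w|u w]; first by rewrite /heis_line scalerDl scalerA.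
by rewrite /heis_line scale0r; apply: heis_eq => //=; rewrite /GRing.scale /=; ring.
Qed.

End Heisenberg.

(** * Semidirect products with an abelian ideal *)

Section Semidirect.
Variables (F : fieldType) (n : nat) (B : lieAlgType F).

Record representation := Representation {
  rep_fun :> B -> 'M[F]_n;
  rep_linear : linear rep_fun;
  rep_bracket : forall b c, rep_fun (bracket b c) =
    rep_fun b *m rep_fun c - rep_fun c *m rep_fun b }.

(** Indexing the type by [r] gives each representation its own bracket on the same vector space. *)
Definition semidirect (r : representation) : Type := ('cV[F]_n * B)%type.

Variable r : representation.

HB.instance Definition _ := GRing.Lmodule.on (semidirect r).

Lemma rep0 : r 0 = 0.
Proof.
by have := rep_linear r (-1) 0 0; rewrite scaler0 addr0 scaleN1r addNr.
Qed.

Definition sd_bracket (u v : semidirect r) : semidirect r :=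
  (r u.2 *m v.1 - r v.2 *m u.1, bracket u.2 v.2).

Fact sd_linearl y : linear (fun x => sd_bracket x y).
Proof.
move=> a u v; apply: eq_pair; rewrite /= ?bracket_linearl // rep_linear.
by rewrite mulmxDl mulmxDr -scalemxAl -scalemxAr scalerBr opprD addrACA.
Qed.
Fact sd_bracketC x y : sd_bracket x y = - sd_bracket y x.
Proof.
apply: eq_pair => /=; first by rewrite opprB.
(* Antisymmetry in [B] comes by polarising the alternating law. *)
have := bracketxx (x.2 + y.2).
have Dl (a b c : B) : bracket (a + b) c = bracket a c + bracket b c.
  by have := bracket_linearl c 1 a b; rewrite /= !scale1r.
have Dr (a b c : B) : bracket c (a + b) = bracket c a + bracket c b.
  by have := bracket_linearr c 1 a b; rewrite /= !scale1r.
rewrite Dl !Dr !bracketxx add0r addr0 => /eqP.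
by rewrite addr_eq0 => /eqP.
Qed.
Fact sd_linearr x : linear (fun y => sd_bracket x y).
Proof.
move=> a u v; rewrite /= sd_bracketC sd_linearl opprD -scalerN.
by rewrite -!sd_bracketC.
Qed.
Fact sd_bracketxx x : sd_bracket x x = 0.
Proof. by apply: eq_pair; rewrite /= ?bracketxx // subrr. Qed.
Fact sd_jacobi x y z :
  sd_bracket x (sd_bracket y z) + sd_bracket y (sd_bracket z x)
    + sd_bracket z (sd_bracket x y) = 0.
Proof.
apply: eq_pair; rewrite /= ?jacobi // !rep_bracket !mulmxBr !mulmxBl !mulmxA.
(* Once the six triple products are atoms, the identity is additive in each entry. *)
set a1 := r x.2 *m r y.2 *m _; set a2 := r x.2 *m r z.2 *m _.
set b1 := r y.2 *m r x.2 *m _; set b2 := r y.2 *m r z.2 *m _.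
set c1 := r z.2 *m r x.2 *m _; set c2 := r z.2 *m r y.2 *m _.
by apply/matrixP => i j; rewrite !mxE; ring.
Qed.

HB.instance Definition _ := @Lmodule_isLieAlgebra.Build F (semidirect r) sd_bracket
  sd_linearl sd_linearr sd_bracketxx sd_jacobi.

(** In a fourfold bracket the vector part only involves products of three operators, once [r] of a
    bracket is expanded as a commutator. *)
Lemma semidirect_nilpotent k : (3 <= k)%N ->
  (forall x y z : B, bracket x (bracket y z) = 0) ->
  (forall x y z : B, r x *m r y *m r z = 0) ->
  nilpotent_le k (semidirect r : lieAlgType F).
Proof.
move=> k3 B0 r0; apply: nilpotent_le_class3 => // x y z t.
have rb a b c : r a *m r (bracket b c) = 0.
  by rewrite rep_bracket mulmxBr !mulmxA !r0 subrr.
apply: eq_pair; rewrite /= !B0 ?bracket0r // rep0 mul0mx subr0.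
by rewrite !mulmxBr !mulmxA !r0 rb !mul0mx !subr0.
Qed.

End Semidirect.

(** * Split extensions of the Heisenberg algebra by an abelian algebra *)

Section NilLie.
Variables (F : fieldType) (k : nat).
Hypothesis k3 : (3 <= k)%N.

Lemma is_zero_homP (A B : Nil_Lie F k) (h : Hom A B) :
  is_zero_hom h <-> forall x, sval h x = 0.
Proof.
have zero0 (A' B' : Nil_Lie F k) (f : Hom A' B') :
    is_zero_hom f -> forall x, sval f x = 0.
  move=> [Z [g [f' [Z0 ->]]]] x /=.
  have f0 : lie_morphism (fun _ : sval Z => 0 : sval B').
    by split=> [c u v|u v]; rewrite ?scaler0 ?addr0 ?bracket0l.
  (* The only morphism out of a zero object is the constant 0. *)
  have [_ [g' [_ gP]]] := Z0 B'.
  by rewrite -(gP g I) (gP (exist _ _ f0) I).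
split; first exact: zero0.
move=> h0; have [f f0] := zero_hom_exists A B (Nil_Lie_pointed F k).
suff -> : h = f by [].
by apply: nil_lie_homP => x; rewrite h0 zero0.
Qed.

Variable n : nat.

Definition abelian_ob : Nil_Lie F k :=
  exist _ (abelian_lie 'cV[F]_n : lieAlgType F)
    (abelian_nilpotent 'cV[F]_n k3).

Definition heisenberg_ob : Nil_Lie F k :=
  exist _ (heisenberg F : lieAlgType F)
    (nilpotent_le_class3 k3 (fun x y z t => heis_bracket3 x y (bracket z t))).

Definition heis_line_hom (v : heisenberg F) : Hom heisenberg_ob heisenberg_ob :=
  exist _ _ (heis_line_morphism v).

Section SquareZero.
Variables P Q : 'M[F]_n.
Hypotheses (PP : P *m P = 0) (QQ : Q *m Q = 0) (QP : Q *m P = 0).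

(** As Q P = 0, the matrix P Q is the commutator [P, Q], which the central element [heis_z] must act
    by. *)
Definition heis_mx (u : heisenberg F) : 'M[F]_n :=
  (u.1.1 : F) *: P + (u.1.2 : F) *: Q + (u.2 : F) *: (P *m Q).

Lemma heis_mxM u v : heis_mx u *m heis_mx v = (u.1.1 * v.1.2 : F) *: (P *m Q).
Proof.
rewrite /heis_mx !mulmxDl !mulmxDr -!scalemxAl -!scalemxAr !mulmxA.
rewrite PP QQ QP -!(mulmxA P Q) QP QQ !mulmx0 !mul0mx !scaler0.
by rewrite !addr0 !add0r scalerA.
Qed.

Lemma heis_mx_linear : linear heis_mx.
Proof.
move=> a u v; rewrite /heis_mx /= !scalerDl !scalerDr !scalerA.
by rewrite [RHS]addrACA; congr (_ + _); rewrite [RHS]addrACA.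
Qed.

Lemma heis_mx_bracket u v : heis_mx (bracket u v) =
  heis_mx u *m heis_mx v - heis_mx v *m heis_mx u.
Proof.
rewrite !heis_mxM -scalerBl /heis_mx /= !scale0r !add0r.
by congr (_ *: _); rewrite (mulrC v.1.1).
Qed.

Definition heis_rep := Representation heis_mx_linear heis_mx_bracket.

(** A product of two values is a multiple of P Q, and P Q P = P Q Q = 0. *)
Lemma heis_rep_mul3 u v w : heis_rep u *m heis_rep v *m heis_rep w = 0.
Proof.
rewrite /= heis_mxM /heis_mx -scalemxAl !mulmxDr -!scalemxAr !mulmxA.
by rewrite -!(mulmxA P Q) QP QQ !(mul0mx, mulmx0, scaler0, addr0).
Qed.

End SquareZero.

Section SemidirectExtension.
Variable r : representation n (heisenberg F).
Hypothesis r3 : forall x y z, r x *m r y *m r z = 0.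

Definition sd_ob : Nil_Lie F k :=
  exist _ (semidirect r : lieAlgType F)
    (semidirect_nilpotent k3 (@heis_bracket3 F) r3).

Fact sd_ker_morphism :
  lie_morphism (fun x : abelian_lie 'cV[F]_n => (x, 0) : semidirect r).
Proof.
split=> [a u v|u v]; apply: eq_pair => //=; first by rewrite scaler0 addr0.
- by rewrite rep0 !mul0mx subrr.
- by rewrite bracket0l.
Qed.
Fact sd_proj_morphism : lie_morphism (fun u : semidirect r => u.2).
Proof. by []. Qed.
Fact sd_sec_morphism :
  lie_morphism (fun b : heisenberg F => (0, b) : semidirect r).
Proof.
split=> [a u v|u v]; apply: eq_pair => //=; first by rewrite scaler0 addr0.
by rewrite !mulmx0 subrr.
Qed.

Definition sd_ker : Hom abelian_ob sd_ob := exist _ _ sd_ker_morphism.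
Definition sd_proj : Hom sd_ob heisenberg_ob := exist _ _ sd_proj_morphism.
Definition sd_sec : Hom heisenberg_ob sd_ob := exist _ _ sd_sec_morphism.

Fact sd_split : sd_proj \oc sd_sec = idc heisenberg_ob.
Proof. exact: nil_lie_homP. Qed.

Fact sd_kerP : is_kernel sd_ker sd_proj.
Proof.
split; first by apply/is_zero_homP.
move=> Z [u uP] /is_zero_homP /= u0.
(* On elements with zero second component the bracket vanishes, since [r] maps 0 to 0. *)
have wP : lie_morphism (fun x => (u x).1 : abelian_lie 'cV[F]_n).
  split=> [a x y|x y]; first by rewrite uP.1.
  by rewrite uP.2 /= !u0 rep0 !mul0mx subrr.
exists (exist _ _ wP : Hom Z abelian_ob); split.
  by apply: nil_lie_homP => x; apply: eq_pair; rewrite /= ?u0.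
move=> w /(congr1 (fun h => sval h)) wu; apply: nil_lie_homP => x /=.
by have /(congr1 (fun h => (h x).1)) := wu.
Qed.

Definition sd_ext : split_ext heisenberg_ob abelian_ob :=
  SplitExt sd_split sd_kerP.

End SemidirectExtension.

(** Pulling back along [f] restricts the action along [f]; the comparison map is the identity on
    vectors and [f] on the acting algebra. *)
Lemma sd_ext_pullback (r r' : representation n (heisenberg F))
    (r3 : forall x y z, r x *m r y *m r z = 0)
    (r3' : forall x y z, r' x *m r' y *m r' z = 0)
    (f : Hom heisenberg_ob heisenberg_ob) :
  (forall b, r' b = r (sval f b)) ->
  is_split_ext_pullback f (sd_ext r3) (sd_ext r3').
Proof.
move=> rf.
have pP : lie_morphism
    (fun u : semidirect r' => (u.1, sval f u.2) : semidirect r).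
  split=> [a u v|u v]; apply: eq_pair => //=.
  - by rewrite (svalP f).1.
  - by rewrite !rf.
  - by rewrite (svalP f).2.
exists (exist _ _ pP : Hom (sd_ob r3') (sd_ob r3)); split; last 2 first.
- by apply: nil_lie_homP => x; apply: eq_pair => //=; rewrite (lie_morphism0 (svalP f)).
- exact: nil_lie_homP.
split; first exact: nil_lie_homP.
move=> Z [u uP] [v vP] uv.
have uvx x : (u x).2 = sval f (v x).
  exact: (congr1 (fun h => sval h x) uv).
have wP : lie_morphism (fun x => ((u x).1, v x) : semidirect r').
  split=> [a x y|x y]; apply: eq_pair; rewrite /= ?uP.1 ?vP.1 ?vP.2 //.
  by rewrite uP.2 /= !rf !uvx.
exists (exist _ _ wP : Hom Z (sd_ob r3')); split.
  by split; apply: nil_lie_homP => x //; apply: eq_pair; rewrite /= ?uvx.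
move=> [w wP'] [w1 w2]; apply: nil_lie_homP => x; apply: eq_pair => /=.
  exact: (esym (congr1 (fun h => (sval h x).1) w1)).
exact: (esym (congr1 (fun h => sval h x) w2)).
Qed.

(* The action is recovered as the bracket of the section with the kernel. *)
Lemma sd_ext_iso_inj (r r' : representation n (heisenberg F))
    (r3 : forall x y z, r x *m r y *m r z = 0)
    (r3' : forall x y z, r' x *m r' y *m r' z = 0) :
  split_ext_iso (sd_ext r3) (sd_ext r3') -> forall b, r b = r' b.
Proof.
move=> [[t tP] [_ tk _ tb]] b.
have tkx x : t (x, 0) = (x, 0) by exact: (congr1 (fun h => sval h x) tk).
have tbx c : t (0, c) = (0, c) by exact: (congr1 (fun h => sval h c) tb).
have act (s : representation n (heisenberg F)) x :
    bracket ((0, b) : semidirect s) (x, 0) = (s b *m x, 0).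
  by apply: eq_pair; rewrite /= ?mulmx0 ?subr0 ?bracket0r.
have rr' (x : 'cV[F]_n) : r b *m x = r' b *m x.
  have : t (bracket ((0, b) : semidirect r) (x, 0)) =
      bracket ((0, b) : semidirect r') (x, 0).
    exact: etrans (tP.2 _ _) (congr2 bracket (tbx b) (tkx x)).
  by rewrite !act tkx => -[].
apply/matrixP => i j.
by have /matrixP /(_ i 0) := rr' (delta_mx j 0); rewrite -!colE !mxE.
Qed.

(** * Elements of a weakly representing object attached to square-zero matrices *)

Section WeakRepresentation.
Variables (T : Nil_Lie F k)
  (tau : natural_mono
    (SplExt (Nil_Lie_pointed F k) (@Nil_Lie_pullbacks F k) abelian_ob)
    (hom_presheaf T)).

Definition heis_class (P Q : 'M[F]_n) (PP : P *m P = 0) (QQ : Q *m Q = 0)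
    (QP : Q *m P = 0) :=
  class_of_split_ext (sd_ext (heis_rep_mul3 PP QQ QP)).

(** Taking Q = 0 lets only the [heis_x] coordinate act, so the line action is still an extension of
    the Heisenberg algebra. *)
Definition line_class (P : 'M[F]_n) (PP : P *m P = 0) :=
  heis_class PP (mulmx0 n 0) (mul0mx n P).

Definition acting_elt (P : 'M[F]_n) (PP : P *m P = 0) : sval T :=
  sval (tau heisenberg_ob (line_class PP)) (heis_x F).

(** [heis_line v] sends u to a multiple of v, which acts by the same multiple of R; naturality of
    [tau] does the rest. *)
Lemma line_class_pullback (P Q R : 'M[F]_n) (PP : P *m P = 0)
    (QQ : Q *m Q = 0) (QP : Q *m P = 0) (RR : R *m R = 0) v :
  heis_mx P Q v = R ->
  tau heisenberg_ob (line_class RR) =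
  tau heisenberg_ob (heis_class PP QQ QP) \oc heis_line_hom v :> Hom _ _.
Proof.
move=> vR; rewrite -[RHS](nattr_natural tau); congr (tau _).
apply/esym/pullback_class_of_split_ext/sd_ext_pullback => b /=.
rewrite -vR /heis_line /heis_mx /= mulmx0 !scaler0 !addr0.
by rewrite !scalerDr !scalerA.
Qed.

(** Evaluation at [heis_x], which [heis_line v] sends to v. A single homomorphism thus takes the
    values phi P, phi Q and phi (P Q). *)
Lemma acting_eltE (P Q R : 'M[F]_n) (PP : P *m P = 0)
    (QQ : Q *m Q = 0) (QP : Q *m P = 0) (RR : R *m R = 0) v :
  heis_mx P Q v = R ->
  acting_elt RR = sval (tau heisenberg_ob (heis_class PP QQ QP)) v.
Proof.
move=> vR; rewrite /acting_elt (line_class_pullback PP QQ QP RR vR) /=.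
by rewrite /heis_line scale1r.
Qed.

Lemma acting_elt_bracket (P Q : 'M[F]_n) (PP : P *m P = 0) (QQ : Q *m Q = 0)
    (QP : Q *m P = 0) (RR : P *m Q *m (P *m Q) = 0) :
  acting_elt RR = bracket (acting_elt PP) (acting_elt QQ).
Proof.
rewrite (acting_eltE PP QQ QP PP (v := heis_x F)); last first.
  by rewrite /heis_mx /= !scale0r scale1r !addr0.
rewrite (acting_eltE PP QQ QP QQ (v := heis_y F)); last first.
  by rewrite /heis_mx /= !scale0r scale1r add0r addr0.
rewrite (acting_eltE PP QQ QP RR (v := heis_z F)); last first.
  by rewrite /heis_mx /= !scale0r scale1r !add0r.
rewrite -heis_bracket_xy.
exact: (svalP (tau heisenberg_ob (heis_class PP QQ QP))).2.
Qed.

Lemma acting_elt_eq0 (P : 'M[F]_n) (PP : P *m P = 0) :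
  acting_elt PP = 0 -> P = 0.
Proof.
move=> P0; have OO := mulmx0 n (0 : 'M[F]_n); have OP := mul0mx n P.
have Px : heis_mx P 0 (heis_x F) = P.
  by rewrite /heis_mx /= scale1r !scale0r !addr0.
have PO : heis_mx P 0 0 = 0 by rewrite /heis_mx /= !scale0r !addr0.
(* Both homomorphisms factor through a line: the first is determined by its value phi P = 0 at
   [heis_x], the second is composed with the zero map. Hence both vanish, and injectivity of [tau]
   compares the two actions at [heis_x]. *)
have /nattr_inj /class_of_split_ext_inj /sd_ext_iso_inj /(_ (heis_x F)) :
    tau heisenberg_ob (line_class PP) = tau heisenberg_ob (line_class OO).
  rewrite (line_class_pullback PP OO OP PP Px).
  rewrite (line_class_pullback PP OO OP OO PO).
  apply: nil_lie_homP => u /=; rewrite /heis_line scaler0.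
  have hP := svalP (tau heisenberg_ob (heis_class PP OO OP)).
  rewrite -[_ *: _]addr0 hP.1 (lie_morphism0 hP) addr0.
  by rewrite -(acting_eltE PP OO OP PP Px) P0 scaler0.
by rewrite /= Px /heis_mx /= !scale1r !scale0r !addr0.
Qed.

End WeakRepresentation.

End NilLie.

(** * Matrix units and the contradiction *)

Lemma delta_mx_square0 (F : fieldType) n (i j : 'I_n) : i != j ->
  delta_mx i j *m delta_mx i j = 0 :> 'M[F]_n.
Proof. by move=> ij; rewrite mul_delta_mx_0 // eq_sym. Qed.

Lemma acting_elt_lower_central (F : fieldType) k (k3 : (3 <= k)%N) n
    (T : Nil_Lie F k)
    (tau : natural_mono
      (SplExt (Nil_Lie_pointed F k) (@Nil_Lie_pullbacks F k)
        (abelian_ob F k3 n.+1)) (hom_presheaf T))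
    m (mn : (m.+1 < n.+1)%N)
    (PP : delta_mx (Ordinal mn) ord0 *m delta_mx (Ordinal mn) ord0 = 0) :
  lower_central (sval T) m (acting_elt tau PP).
Proof.
elim: m mn PP => [//|m IHm] mn PP.
(* Here i = m + 1 and j = m + 2; P = E_(j,i) and Q = E_(i,0) square to zero because j, i and 0 are
   distinct. *)
have mn' := ltnW mn; set i := Ordinal mn'; set j := Ordinal mn in PP *.
have ji : j != i by rewrite -val_eqE /= neq_ltn ltnSn orbT.
have ij : delta_mx i ord0 *m delta_mx j i = 0 :> 'M[F]_n.+1.
  by rewrite mul_delta_mx_0.
have jE : delta_mx j ord0 = delta_mx j i *m delta_mx i ord0 :> 'M[F]_n.+1.
  by rewrite mul_delta_mx.
(* [acting_elt] depends on the proof [PP], so both are rewritten together. *)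
move: PP; rewrite jE => PP.
rewrite (acting_elt_bracket tau (delta_mx_square0 _ ji)
  (@delta_mx_square0 F _ i ord0 isT) ij PP).
exact: lower_central_bracket (IHm mn' _).
Qed.

Local Close Scope classical_set_scope.
Local Close Scope ring_scope.

Theorem theorem3p1 (F : fieldType) (k : nat) (hk : 3 <= k) :
  ~ weakly_action_representable (Nil_Lie_pointed F k) (@Nil_Lie_pullbacks F k).
Proof.
move=> /(_ (abelian_ob F hk k.+2)) [T [tau]].
(* Dimension k + 2 provides the row index k + 1, for which phi E_(k+1,0) lies in T^k = 0. *)
pose i : 'I_k.+2 := Ordinal (ltnSn k.+1).
have := acting_elt_lower_central tau (@delta_mx_square0 F _ i ord0 isT).
rewrite (svalP T : lower_central _ _ = _) => /acting_elt_eq0.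
by move=> /matrixP /(_ i ord0) /eqP; rewrite !mxE !eqxx oner_eq0.
Qed.
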